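(* Let $G$ be a plane triangulation with $n$ vertices and minimum degree $\delta(G)\ge 4$, and suppose $G$ contains a Hamilton cycle $H$. Then $\gamma(G)\le \max\{\lceil 2n/7\rceil, \lfloor 5n/16\rfloor\}$.
   Context: $\gamma(G)$ denotes the domination number of $G$, i.e. the minimum size of a set $D\subseteq V(G)$ such that every vertex of $G$ is in $D$ or adjacent to a vertex of $D$. A plane triangulation is a simple planar graph embedded in the plane in which every face (including the outer face) is bounded by a triangle. *)

(* Defs.v *)
From mathcomp Require Import all_boot all_fingroup.

Set Implicit Arguments.
Unset Strict Implicit.
Unset Printing Implicit Defensive.

Record sgraph := SGraph {
  svertex :> finType;
  adj : rel svertex;
  adj_sym : symmetric adj;
  adj_irrefl : irreflexive adj }.

Section Graph.
Variable G : sgraph.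

Definition degree (v : G) : nat := #|[set w | adj v w]|.

(* Degrees are smaller than the number of vertices, so the default value is
   never attained when G is nonempty. *)
Definition min_degree : nat := \big[minn/#|G|]_(v : G) degree v.

Definition dominating (D : {set G}) : bool :=
  [forall v, (v \in D) || [exists w in D, adj v w]].

Definition domination_number : nat :=
  #|[arg min_(D < [set: G] | dominating D) #|D|]|.

Definition hamilton_cycle (H : seq G) : Prop :=
  [/\ 2 < size H, uniq H, path.cycle (@adj G) H & forall v : G, v \in H].

Definition dart : finType := {p : G * G | adj p.1 p.2}.

Definition tail (x : dart) : G := (val x).1.
Definition head (x : dart) : G := (val x).2.

Lemma flip_subproof (x : dart) : adj (head x, tail x).1 (head x, tail x).2.
Proof. by rewrite adj_sym; exact: (valP x). Qed.

Definition flip_fun (x : dart) : dart := Sub (head x, tail x) (flip_subproof x).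

Lemma flip_funK : involutive flip_fun.
Proof. by move=> x; apply: val_inj; case: x => [[u v] p]. Qed.

Definition flip : {perm dart} := perm (inv_inj flip_funK).

(* Embeddings are described by rotation systems: r sends a dart (u, v) to the
   dart that follows it in the cyclic order of the darts leaving u around u. *)
Definition rotation_system (r : {perm dart}) : Prop :=
  forall x y : dart, (y \in porbit r x) = (tail y == tail x).

(* One step along a facial walk: follow (u, v), then leave v along the dart
   that comes after (v, u) around v. *)
Definition face_perm (r : {perm dart}) : {perm dart} := (flip * r)%g.

Definition edges : {set {set dart}} := porbits flip.
Definition faces (r : {perm dart}) : {set {set dart}} := porbits (face_perm r).

(* A rotation system of a connected graph with at least one edge determines,
   up to homeomorphism, a cellular embedding in a closed oriented surface whose
   faces are the discs glued along the orbits of face_perm. The surface is the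
   sphere, i.e. the plane with the outer face among the faces, exactly when its
   Euler characteristic V - E + F is 2. *)
Definition plane_embedding (r : {perm dart}) : Prop :=
  [/\ rotation_system r,
      forall u v : G, connect (@adj G) u v
    & #|G| + #|faces r| = #|edges| + 2].

(* As the graph is simple, a facial walk of length 3 is a triangle. *)
Definition plane_triangulation (r : {perm dart}) : Prop :=
  plane_embedding r /\ {in faces r, forall f : {set dart}, #|f| = 3}.

End Graph.

Definition ceil_divn (m d : nat) : nat := (m + d.-1) %/ d.

(* Main.v *)
(* A Hamilton cycle splits the sphere into a left and a right triangulated
   polygon. Colour the vertices with four colours so that, on one chosen side,
   any two triangles sharing a chord use all four. Such a colouring exists
   because the dual graph of the triangles, cut along the cycle, is a forest:
   by Euler's formula it has two more faces than chords, and it has at most two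
   components, since rotating around the cycle vertices links all the left
   (right) triangles; no Jordan curve theorem is needed. Each vertex in at least
   two triangles of the side sees all four colours, and an ear (a vertex in a
   single triangle) misses only one, so adding to each colour class the ears
   that miss it gives four dominating sets of total size n + t, where t is the
   number of ears; hence 4 gamma <= n + t for either side.
   On the other hand, the neighbours on the cycle of an ear of either side are
   adjacent, and as no vertex is an ear of both sides there are N = n - t - t'
   vertices that are not ears. Cut the cycle greedily into blocks of 5, 4 or 3
   consecutive vertices, each dominated by one of its vertices: a block of
   length l contains at least 5 - l non-ears, so 5 gamma <= n + N + 4, and a good
   choice of the starting vertex improves this to n + N + 2 when 3 N > n. The
   bounds combine into the claim. *)
Require Import Defs.
From mathcomp Require Import all_boot all_fingroup zify.

Set Implicit Arguments.
Unset Strict Implicit.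
Unset Printing Implicit Defensive.

Section Tiling.
Variable f : nat -> bool.

Definition reaches (c q : nat) : bool :=
  [|| q == c, q == c.+1, c == q.+1, (q == c.+2) && f c.+1
    | (c == q.+2) && f q.+1].

Definition gaps (p k : nat) : nat := count (predC f) (iota p k).

Lemma gapsD p k l : gaps p (k + l) = gaps p k + gaps (p + k) l.
Proof. by rewrite /gaps iotaD count_cat. Qed.

Lemma gaps_last p k : 0 < k -> ~~ f (p + k).-1 <= gaps p k.
Proof.
case: k => // k _; rewrite -addn1 gapsD addn1 addnS /= /gaps /=; lia.
Qed.

Lemma tile p : exists c l,
  [/\ 3 <= l <= 5, forall q, p <= q < p + l -> reaches c q,
      5 + ~~ f p <= l + gaps p l
    & ~~ f p -> f p.+1 -> ~~ f p.+2 -> 7 <= l + gaps p l].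
Proof.
suff: exists c l, [/\ 3 <= l <= 5, all (reaches c) (iota p l),
      5 + ~~ f p <= l + gaps p l
    & ~~ f p -> f p.+1 -> ~~ f p.+2 -> 7 <= l + gaps p l].
  case=> c [l [hl /allP hc h1 h2]]; exists c, l; split=> // q hq.
  by apply: hc; rewrite mem_iota.
case f1: (f p.+1); case f2: (f p.+2); case f3: (f p.+3);
  [ exists p.+2, 5 | exists p.+2, 4 | exists p.+2, 5 | exists p.+2, 4
  | exists p.+1, 4 | exists p.+1, 4 | exists p.+1, 3 | exists p.+1, 3 ];
  rewrite /gaps /reaches /= f1 f2 ?f3 /=; split; lia.
Qed.

Lemma cover_interval k p : 0 < k -> exists D : seq nat,
  (forall q, p <= q < p + k -> has (reaches^~ q) D)
  /\ 5 * size D + ~~ f (p + k).-1 <= k + 4 + gaps p k.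
Proof.
elim/ltn_ind: k p => k IH p k0; have [c [l [hl hc h1 _]]] := tile p.
have [kl|lk] := leqP k l.
  exists [:: c]; split=> [q hq|] /=; first by rewrite hc ?orbF //; lia.
  by have := gaps_last p k0; lia.
have [||D [hD h]] := IH (k - l) _ (p + l); first by lia.
  by rewrite subn_gt0.
exists (c :: D); split=> [q hq|] /=.
  have [ql|lq] := ltnP q (p + l); first by rewrite hc //; lia.
  by rewrite hD ?orbT //; lia.
have -> : gaps p k = gaps p l + gaps (p + l) (k - l).
  by rewrite -gapsD subnKC // ltnW.
by move: h; rewrite -addnA (subnKC (ltnW lk)); lia.
Qed.

Lemma cover_interval_gap_start k p : 5 < k -> ~~ f p ->
  ~~ f (p + k).-1 \/ f p.+1 /\ ~~ f p.+2 ->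
  exists D : seq nat,
  (forall q, p <= q < p + k -> has (reaches^~ q) D)
  /\ 5 * size D <= k + 2 + gaps p k.
Proof.
move=> k5 fp hf; have [c [l [hl hc h1 h2]]] := tile p.
have [|D [hD h]] := @cover_interval (k - l) (p + l); first by lia.
exists (c :: D); split=> [q hq|] /=.
  have [ql|lq] := ltnP q (p + l); first by rewrite hc //; lia.
  by rewrite hD ?orbT //; lia.
have lk : l <= k by lia.
have -> : gaps p k = gaps p l + gaps (p + l) (k - l).
  by rewrite -gapsD subnKC.
move: h; rewrite -addnA (subnKC lk).
case: hf => [-> | [fp1 fp2]]; last have := h2 fp fp1 fp2; lia.
Qed.

End Tiling.

(* Each edge lowers the number of classes of [rho] by at most one; in the equality
   case every edge joins two classes, so the potential [a] can be corrected on one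
   of them. *)
Lemma forest_potential (U : finType) (gT : finGroupType) (A : {set U})
    (s : seq (U * U * gT)) :
  exists (rho : U -> U) (a : U -> gT),
  [/\ forall e, e \in s -> rho e.1.1 = rho e.1.2,
      #|A| <= #|rho @: A| + size s
    & #|A| = #|rho @: A| + size s ->
      forall e, e \in s -> a e.1.2 = (e.2 * a e.1.1)%g].
Proof.
elim: s => [|[[u v] t] s [rho [a [hrho hle ha]]]].
  by exists id, (fun=> 1%g); split=> //; rewrite imset_id addn0.
have [uv|uv] := eqVneq (rho u) (rho v).
  exists rho, a; split=> /=; last by move=> h; lia.
    by move=> e; rewrite inE => /predU1P[-> //|]; apply: hrho.
  by rewrite addnS ltnW.
pose rho' x := if rho x == rho v then rho u else rho x.
pose a' x := if rho x == rho v then (a x * ((a v)^-1 * (t * a u)))%g else a x.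
have hcard : #|rho @: A| <= #|rho' @: A|.+1.
  rewrite (cardsD1 (rho v)) -add1n leq_add ?leq_b1 // subset_leq_card //.
  apply/subsetP=> y /setD1P[yv /imsetP[x xA yx]]; apply/imsetP; exists x => //.
  by rewrite /rho' -yx (negbTE yv).
exists rho', a'; split=> /= [e||hs e].
- rewrite inE => /predU1P[-> /=|/hrho es]; last by rewrite /rho' es.
  by rewrite /rho' eqxx; case: ifP.
- by lia.
- rewrite inE => /predU1P[-> /=|es].
    by rewrite /a' eqxx (negbTE uv) mulgA mulgV mul1g.
  have {}ha : a e.1.2 = (e.2 * a e.1.1)%g by apply: ha => //; lia.
  by rewrite /a' (hrho _ es); case: ifP; rewrite ha ?mulgA.
Qed.
Section FirstHit.
Variables (T : finType) (s : {perm T}).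

Lemma first_hit (U : Type) (F : T -> U) (P : pred T) (x z : T) :
  (forall y, ~~ P y -> F (s y) = F y) -> z \in porbit s x -> P z ->
  exists i, [/\ P ((s ^+ i)%g x), F ((s ^+ i)%g x) = F x
              & forall j, j < i -> ~~ P ((s ^+ j)%g x)].
Proof.
move=> hF /porbitP[m ->] Pm.
have ex : exists i, P ((s ^+ i)%g x) by exists m.
case: (ex_minnP ex) => i Pi mini; exists i; split=> // [|j ji].
  have: forall j, j < i -> ~~ P ((s ^+ j)%g x).
    by move=> j ji; apply/negP=> /mini; rewrite leqNgt ji.
  elim: (i) => [|j IH] hj; first by rewrite expg0 perm1.
  rewrite expgSr permM hF ?hj // IH // => l lj.
  by apply: hj; apply: ltnW.
by apply/negP=> /mini; rewrite leqNgt ji.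
Qed.

Lemma sector (U : Type) (F : T -> U) (g h : T) :
  h \in porbit s g -> h != g ->
  (forall y, y != h -> y != g -> F (s y) = F y) -> F (s g) = F h.
Proof.
move=> hg neq hF; pose P := pred2 h g.
have hP y : ~~ P y -> F (s y) = F y by rewrite negb_or => /andP[]; apply: hF.
have gin : g \in porbit s (s g).
  by rewrite porbit_sym -(porbit_perm s 1 g) porbit_id.
have Pg : P g by rewrite /P /= eqxx orbT.
have [i [/orP[/eqP-> //|/eqP hi] Fi hj]] := first_hit hP gin Pg.
have hiS : (s ^+ i.+1)%g g = g by rewrite expgS permM.
have /porbitP[m hm] := hg.
have hmod : (s ^+ (m %% i.+1))%g g = h.
  rewrite hm {2}(divn_eq m i.+1) expgD permM mulnC expgM.
  suff -> : (s ^+ i.+1 ^+ (m %/ i.+1))%g g = g by [].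
  by elim: (m %/ _) => [|k IH]; rewrite ?expg0 ?perm1 // expgS permM hiS.
case: (m %% i.+1) (ltn_pmod m (ltn0Sn i)) hmod => [|j] ji.
  by rewrite expg0 perm1 => gh; rewrite gh eqxx in neq.
rewrite expgS permM => hh; have := hj j ji.
by rewrite hh /P /= eqxx.
Qed.

Lemma card_uniform_porbits k :
  (forall x, #|porbit s x| = k) -> #|porbits s| * k = #|T|.
Proof.
move=> hk; rewrite -sum_nat_const -[RHS]sum1_card (partition_big_imset (porbit s)) /=.
apply: eq_bigr => _ /imsetP[y _ ->]; rewrite -(hk y) -sum1_card.
by apply: eq_bigl => x; rewrite eq_porbit_mem.
Qed.

End FirstHit.
(* A frame at a dart x is a permutation giving the colours of the tail of x
   (role 0), the head of x (role 1), the third vertex of the face of x (role 2)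
   and the missing colour (role 3), which is the colour of the opposite vertex
   across x. *)
Definition role (i : nat) : 'I_4 := inord i.

Definition turn : 'S_4 := (tperm (role 0) (role 1) * tperm (role 0) (role 2))%g.
Definition cross : 'S_4 := (tperm (role 0) (role 1) * tperm (role 2) (role 3))%g.

Lemma role_eq i j : i < 4 -> j < 4 -> (role i == role j) = (i == j).
Proof. by move=> hi hj; rewrite -val_eqE /= !inordK. Qed.

Lemma role_cases (P : 'I_4 -> Prop) :
  P (role 0) -> P (role 1) -> P (role 2) -> P (role 3) -> forall i, P i.
Proof.
move=> h0 h1 h2 h3 i; rewrite -[i]inord_val -/(role _).
by case: i => [[|[|[|[|]]]] //=].
Qed.

Lemma turnE : ((turn (role 0) = role 1) * (turn (role 1) = role 2)
            * (turn (role 2) = role 0) * (turn (role 3) = role 3))%type.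
Proof. by rewrite /turn !permM !permE /= !(role_eq, eqxx). Qed.

Lemma crossE : ((cross (role 0) = role 1) * (cross (role 1) = role 0)
            * (cross (role 2) = role 3) * (cross (role 3) = role 2))%type.
Proof. by rewrite /cross !permM !permE /= !(role_eq, eqxx). Qed.

Lemma turn3 : (turn * (turn * turn) = 1)%g.
Proof.
by apply/permP=> i; elim/role_cases: i; rewrite 2!permM perm1 !turnE.
Qed.

Lemma cross2 : (cross * cross = 1)%g.
Proof.
by apply/permP=> i; elim/role_cases: i; rewrite permM perm1 !crossE.
Qed.

Local Notation head := Defs.head.

Section Triangulation.
Variables (G : sgraph) (r : {perm dart G}).
Hypothesis hG : plane_triangulation r.
Local Notation phi := (face_perm r).

Lemma tail_flip x : tail (flip G x) = head x. Proof. by rewrite permE. Qed.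
Lemma head_flip x : head (flip G x) = tail x. Proof. by rewrite permE. Qed.
Lemma flipK : involutive (flip G).
Proof. by move=> x; rewrite !permE flip_funK. Qed.

Lemma dart_inj (x y : dart G) : tail x = tail y -> head x = head y -> x = y.
Proof.
by case: x y => [[a b] p] [[c d] q]; rewrite /tail /head /= => ? ?;
   apply: val_inj; congr pair.
Qed.

Lemma adj_dart (x : dart G) : adj (tail x) (head x).
Proof. exact: (valP x). Qed.

Lemma tail_head_neq (x : dart G) : tail x != head x.
Proof. by apply/eqP=> e; have := adj_dart x; rewrite e adj_irrefl. Qed.

Lemma tail_rot x : tail (r x) = tail x.
Proof.
have [[hrot _ _] _] := hG; apply/eqP; rewrite -(hrot x).
by have := mem_porbit r 1 x; rewrite expg1.
Qed.

Lemma faceE x : phi x = r (flip G x). Proof. by rewrite permM. Qed.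
Lemma face_flip x : phi (flip G x) = r x. Proof. by rewrite faceE flipK. Qed.
Lemma tail_face x : tail (phi x) = head x.
Proof. by rewrite faceE tail_rot tail_flip. Qed.

Lemma card_face x : #|porbit phi x| = 3.
Proof. by have [_] := hG; apply; apply: imset_f. Qed.

Lemma face3 x : phi (phi (phi x)) = x.
Proof. by have := iter_porbit phi x; rewrite card_face. Qed.

Lemma head_face2 x : head (phi (phi x)) = tail x.
Proof. by rewrite -tail_face face3. Qed.

Lemma face_neq x : phi x != x.
Proof.
by apply/eqP=> e; have := tail_head_neq x; rewrite -tail_face e eqxx.
Qed.

Lemma porbit_face x : porbit phi (phi x) = porbit phi x.
Proof. by have := porbit_perm phi 1 x; rewrite expg1. Qed.

Lemma exists_frame : exists s : dart G -> 'S_4,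
  forall x, s (phi x) = (turn * s x)%g.
Proof.
pose b x := odflt x [pick y in porbit phi x].
have bin x : b x \in porbit phi x.
  by rewrite /b; case: pickP => [//|/(_ x)]; rewrite porbit_id.
have bphi x : b (phi x) = b x.
  rewrite /b porbit_face; case: pickP => [//|/(_ x)].
  by rewrite porbit_id.
exists (fun x => if x == b x then 1 else
                 if x == phi (b x) then turn else turn * turn)%g => x.
rewrite bphi; have : x \in porbit phi (b x) by rewrite porbit_sym.
move: (b x) => y; rewrite porbit_traject card_face !inE.
have ne1 := face_neq y; have ne2 := face_neq (phi y).
have ne3 : phi (phi y) != y by rewrite -{2}(face3 y) eq_sym face_neq.
case/or3P=> /eqP->.
- by rewrite eqxx (negbTE ne1) eqxx mulg1.
- by rewrite (negbTE ne3) (negbTE ne2) (negbTE ne1) eqxx.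
- by rewrite face3 eqxx (negbTE ne3) (negbTE ne2) turn3.
Qed.

Lemma card_faces : #|faces r| * 3 = #|dart G|.
Proof. exact/card_uniform_porbits/card_face. Qed.

Lemma flip_neq x : flip G x != x.
Proof.
by apply/eqP=> e; have := tail_head_neq x; rewrite -tail_flip e eqxx.
Qed.

Lemma card_edges : #|edges G| * 2 = #|dart G|.
Proof.
apply: card_uniform_porbits => x.
have -> : porbit (flip G) x = [set x; flip G x].
  apply/setP=> y; rewrite !inE; apply/porbitP/orP => [[i ->]|].
    elim: i => [|i]; first by rewrite expg0 perm1 eqxx; left.
    rewrite expgSr permM => -[/eqP->|/eqP->]; first by right.
    by left; rewrite flipK.
  by case=> /eqP->; [exists 0; rewrite expg0 perm1 | exists 1; rewrite expg1].
by rewrite cards2 eq_sym flip_neq.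
Qed.

(* [h v] and [g v] are the forward and the backward dart of the cycle at [v]. *)
Section Hamilton.
Variables (nx : G -> G) (h g : G -> dart G).
Hypothesis tail_h : forall v, tail (h v) = v.
Hypothesis tail_g : forall v, tail (g v) = v.
Hypothesis flip_h : forall v, flip G (h v) = g (nx v).
Hypothesis hg_neq : forall v, h v != g v.
Hypothesis nx_trans : forall v w, exists2 i, i < #|G| & w = iter i nx v.

Definition on_cycle (x : dart G) : bool := (x == h (tail x)) || (x == g (tail x)).

Lemma nx_surj v : exists w, v = nx w.
Proof.
have [[|i] _ e] := nx_trans (nx v) v; last by exists (iter i nx (nx v)).
by exists v.
Qed.

Lemma on_cycle_flip x : on_cycle (flip G x) = on_cycle x.
Proof.
suff imp y : on_cycle y -> on_cycle (flip G y).
  by apply/idP/idP=> /imp //; rewrite flipK.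
case/orP=> /eqP->; first by rewrite flip_h /on_cycle tail_g eqxx orbT.
have [w ->] := nx_surj (tail y).
by rewrite -flip_h flipK /on_cycle tail_h eqxx.
Qed.

Lemma card_on_cycle : #|[set x | on_cycle x]| = #|G| * 2.
Proof.
have -> : [set x | on_cycle x] = (h @: G) :|: (g @: G).
  apply/setP=> x; rewrite !inE; apply/orP/orP=> -[].
  - by move/eqP->; left; apply: imset_f.
  - by move/eqP->; right; apply: imset_f.
  - by case/imsetP=> v _ ->; left; rewrite tail_h.
  - by case/imsetP=> v _ ->; right; rewrite tail_g.
rewrite cardsU !card_imset; last first.
- exact: (can_inj tail_h).
- exact: (can_inj tail_g).
suff -> : h @: G :&: g @: G = set0 by rewrite cards0 subn0 muln2 addnn.
apply/setP=> x; rewrite !inE; apply/negP=> /andP[/imsetP[v _ ->]] /imsetP[w _ e].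
by have := hg_neq v; rewrite e -(tail_h v) e tail_g eqxx.
Qed.

(* One of the two darts of each edge off the cycle. *)
Definition chords : {set dart G} :=
  [set x | ~~ on_cycle x && (enum_rank x < enum_rank (flip G x))].

Lemma chordsP x : ~~ on_cycle x -> x \in chords \/ flip G x \in chords.
Proof.
move=> hx; rewrite !inE on_cycle_flip hx flipK /=.
case: ltngtP; [by left|by right|move/val_inj/enum_rank_inj/eqP].
by rewrite eq_sym (negbTE (flip_neq x)).
Qed.

Lemma card_chords : #|chords| * 2 + #|G| * 2 = #|dart G|.
Proof.
rewrite -card_on_cycle -[RHS](cardsC [set x | on_cycle x]) addnC; congr addn.
have -> : ~: [set x | on_cycle x] = chords :|: flip G @: chords.
  apply/setP=> x; rewrite !inE; apply/idP/orP=> [/chordsP[]|[|]].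
  - by rewrite inE; left.
  - by move=> hx; right; apply/imsetP; exists (flip G x); rewrite ?flipK.
  - by case/andP.
  - by case/imsetP=> y; rewrite inE => /andP[hy _] ->; rewrite on_cycle_flip.
rewrite cardsU card_imset; last exact: perm_inj.
suff -> : chords :&: flip G @: chords = set0 by rewrite cards0 subn0 muln2 addnn.
apply/setP=> x; rewrite !inE; apply/negP=> /andP[/andP[_ h1] /imsetP[y]].
by rewrite inE => /andP[_ h2] e; move: h1; rewrite e flipK ltnNge ltnW.
Qed.

Lemma card_chords_faces : #|chords| + 2 = #|faces r|.
Proof.
have [[_ _ he] _] := hG.
have := card_faces; have := card_edges; have := card_chords; lia.
Qed.

(* The corner of [x], which precedes [x] in the rotation, lies in one of the two
   sectors cut out by the cycle at [tail x]; the sector after [g v], up to [h v],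
   is on the left of the cycle. *)
Lemma sector_dart (U : Type) (F : dart G -> U) x :
  (forall y, ~~ on_cycle y -> F (r y) = F y) ->
  F x = F (h (tail x)) \/ F x = F (g (tail x)).
Proof.
move=> hF; have [[hrot _ _] _] := hG.
have hin : h (tail x) \in porbit r x by rewrite hrot tail_h.
have hon : on_cycle (h (tail x)) by rewrite /on_cycle tail_h eqxx.
have [i [Pi <- _]] := first_hit hF hin hon.
have -> : tail x = tail ((r ^+ i)%g x).
  by apply/esym/eqP; rewrite -hrot mem_porbit.
by case/orP: Pi => /eqP <-; [left|right].
Qed.

Lemma sector_left (U : Type) (F : dart G -> U) v :
  (forall y, ~~ on_cycle y -> F (r y) = F y) -> F (r (g v)) = F (h v).
Proof.
move=> hF; have [[hrot _ _] _] := hG; pose F' y := if tail y == v then Some (F y) else None.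
have hh : h v \in porbit r (g v) by rewrite hrot tail_h tail_g.
suff : F' (r (g v)) = F' (h v).
  by rewrite /F' tail_rot tail_h tail_g eqxx => -[].
apply: (sector hh) => // y yh yg; rewrite /F' tail_rot; case: eqP => // yv.
by congr Some; apply: hF; rewrite /on_cycle yv negb_or yh.
Qed.

Lemma sector_right (U : Type) (F : dart G -> U) v :
  (forall y, ~~ on_cycle y -> F (r y) = F y) -> F (r (h v)) = F (g v).
Proof.
move=> hF; have [[hrot _ _] _] := hG; pose F' y := if tail y == v then Some (F y) else None.
have hh : g v \in porbit r (h v) by rewrite hrot tail_h tail_g.
suff : F' (r (h v)) = F' (g v).
  by rewrite /F' tail_rot tail_h tail_g eqxx => -[].
apply: (sector hh) => [|y yh yg]; first by rewrite eq_sym.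
rewrite /F' tail_rot; case: eqP => // yv.
by congr Some; apply: hF; rewrite /on_cycle yv negb_or yh yg.
Qed.

Lemma side_const (U : Type) (R : dart G -> U) :
  (forall x, R (phi x) = R x) ->
  (forall x, ~~ on_cycle x -> R (flip G x) = R x) ->
  forall v w, R (h v) = R (h w) /\ R (g v) = R (g w).
Proof.
move=> Rphi Rflip.
have hR y : ~~ on_cycle y -> R (r y) = R y.
  by move=> hy; rewrite -face_flip Rphi Rflip.
have step v : R (h (nx v)) = R (h v) /\ R (g (nx v)) = R (g v).
  rewrite -(sector_left (nx v) hR) -(sector_right v hR) -!face_flip !Rphi.
  by rewrite -flip_h flipK.
move=> v w; have [i _ ->] := nx_trans v w.
by elim: i => //= i [-> ->]; have [-> ->] := step (iter i nx v).
Qed.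

Lemma exists_coloring : exists (R : dart G -> {set dart G}) (s : dart G -> 'S_4),
  [/\ forall x, R (phi x) = R x,
      forall x, ~~ on_cycle x -> R (flip G x) = R x,
      forall v, R (h v) <> R (g v),
      forall x, s (phi x) = (turn * s x)%g
    & forall x, ~~ on_cycle x -> s (flip G x) = (cross * s x)%g].
Proof.
have [s0 hs0] := exists_frame.
pose e x := (porbit phi x, porbit phi (flip G x),
             (s0 (flip G x))^-1 * (cross * s0 x))%g.
have [rho [a [h1 h2 h3]]] :=
  forest_potential (faces r) [seq e x | x <- enum chords].
pose R x := rho (porbit phi x).
have Rphi x : R (phi x) = R x by rewrite /R porbit_face.
have Rflip x : ~~ on_cycle x -> R (flip G x) = R x.
  case/chordsP=> hx.
    by apply/esym; apply: (h1 (e x)); rewrite map_f ?mem_enum.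
  by have := h1 (e (flip G x)); rewrite /= flipK; apply; rewrite map_f ?mem_enum.
have hR y : ~~ on_cycle y -> R (r y) = R y.
  by move=> hy; rewrite -face_flip Rphi Rflip.
have Rsub v : rho @: faces r \subset [set R (h v); R (g v)].
  apply/subsetP=> _ /imsetP[_ /imsetP[x _ ->] ->]; rewrite !inE -/(R x).
  have [e1 e2] := side_const Rphi Rflip v (tail x).
  by rewrite e1 e2; case: (sector_dart x hR) => ->; rewrite eqxx ?orbT.
have sz : size [seq e x | x <- enum chords] = #|chords| by rewrite size_map -cardE.
have hc := card_chords_faces.
rewrite sz in h2 h3.
have hle v := subset_leq_card (Rsub v).
have Rneq v : R (h v) <> R (g v).
  by move=> ee; have := hle v; rewrite ee setUid cards1; lia.
exists R, (fun x => s0 x * a (porbit phi x))%g; split=> // [x|x].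
  by rewrite porbit_face hs0 mulgA.
have {}h3 y : y \in chords -> a (porbit phi (flip G y)) =
    ((s0 (flip G y))^-1 * (cross * s0 y) * a (porbit phi y))%g.
  move=> hy; apply: (h3 _ (e y)); last by rewrite map_f ?mem_enum.
  by have := hle (tail y); rewrite cards2; case: (_ != _); lia.
case/chordsP=> hx; have := h3 _ hx; rewrite ?flipK => ->.
  by rewrite !mulgA mulgV mul1g.
by rewrite -(mulgA _ _ (a _)) mulKVg 2!mulgA cross2 mul1g.
Qed.

Definition ear (v : G) : bool := r (g v) == h v.

Lemma exists_side_coloring : exists col : G -> 'I_4,
  (forall v k, ~~ ear v -> exists2 w, (w == v) || adj v w & col w = k)
  /\ (forall v, exists k0, forall k, k != k0 ->
        exists2 w, (w == v) || adj v w & col w = k).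
Proof.
have [R [s [Rphi Rflip Rneq sphi sflip]]] := exists_coloring.
have hR y : ~~ on_cycle y -> R (r y) = R y.
  by move=> hy; rewrite -face_flip Rphi Rflip.
pose F y := (R y, s y (role 0)).
have hF y : ~~ on_cycle y -> F (r y) = F y.
  move=> hy; rewrite /F hR //; congr pair.
  by rewrite -face_flip sphi permM turnE sflip // permM crossE.
pose col v := s (h v) (role 0).
have colE v y : R y = R (h v) -> col (tail y) = s y (role 0).
  move=> Ry; case: (sector_dart y hF) => -[Ry' -> //].
  case: (Rneq v); rewrite -Ry Ry'.
  by have [_ ->] := side_const Rphi Rflip v (tail y).
have tri y v : R y = R (h v) -> tail y = v -> forall j, j != role 3 ->
    exists2 w, (w == v) || adj v w & col w = s y j.
  move=> Ry yv; elim/role_cases.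
  - by exists v; rewrite ?eqxx // -(colE v) ?yv.
  - exists (tail (phi y)); first by rewrite tail_face -yv adj_dart orbT.
    by rewrite (colE v) ?Rphi // sphi permM turnE.
  - exists (tail (phi (phi y))); last first.
      by rewrite (colE v) ?Rphi // !sphi 2!permM !turnE.
    by rewrite adj_sym -yv -(head_face2 y) adj_dart orbT.
  - by rewrite eqxx.
exists col; split=> [v k earv|v].
  pose y := r (g v).
  have Ry : R y = R (h v) by apply: sector_left.
  have yv : tail y = v by rewrite tail_rot.
  have yon : ~~ on_cycle y.
    rewrite /on_cycle yv negb_or earv; apply/negP=> /eqP yg.
    have := @sector_left _ (fun z => z == g v) v.
    rewrite -/y yg eqxx (negbTE (hg_neq v)) => hcontra.
    suff: true = false by []. apply: hcontra => z _.
    by rewrite -{1}yg (inj_eq perm_inj).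
  have [->|j3] := eqVneq k (s y (role 3)).
    exists (tail (phi (phi (flip G y)))).
      by rewrite face_flip tail_face -yv -(tail_rot y) adj_dart orbT.
    rewrite (colE v) ?Rphi ?Rflip // !sphi 2!permM !turnE.
    by rewrite sflip // permM crossE.
  rewrite -(permKV (s y) k); apply: tri => //.
  by apply: contraNneq j3 => <-; rewrite permKV.
exists (s (h v) (role 3)) => k kn.
rewrite -(permKV (s (h v)) k); apply: tri => //.
by apply: contraNneq kn => <-; rewrite permKV.
Qed.

Lemma domination_number_le (D : {set G}) :
  dominating D -> domination_number G <= #|D|.
Proof.
move=> hD; rewrite /domination_number; case: arg_minnP => [|E _]; last exact.
by apply/forallP=> v; rewrite inE.
Qed.

Lemma domination_number_side :
  4 * domination_number G <= #|G| + #|[set v | ear v]|.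
Proof.
have [col [hcol hcol']] := exists_side_coloring.
pose cov v k := [exists w, ((w == v) || adj v w) && (col w == k)].
have covI v k : (exists2 w, (w == v) || adj v w & col w = k) -> cov v k.
  by case=> w hw ck; apply/existsP; exists w; rewrite hw ck eqxx.
pose C k := [set v | col v == k]; pose B k := [set v | ~~ cov v k].
have hD k : domination_number G <= #|C k| + #|B k|.
  apply: leq_trans (leq_card_setU _ _).
  apply: domination_number_le; apply/forallP=> v; rewrite !inE.
  case hv: (cov v k); last by rewrite orbT.
  have /existsP[w /andP[/orP[/eqP<- -> //|vw] cw]] := hv.
  by apply/orP; right; apply/existsP; exists w; rewrite !inE cw vw.
have -> : 4 * domination_number G = \sum_(k < 4) domination_number G.
  by rewrite sum_nat_const card_ord.
apply: leq_trans (leq_sum _ (fun k _ => hD k)) _.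
rewrite big_split /= leq_add //.
  rewrite -sum1_card (partition_big col predT) //= leq_sum // => k _.
  by rewrite -sum1_card leq_eqVlt; apply/orP; left; apply/eqP/eq_bigl => v; rewrite inE.
have cardb (P : pred G) : #|[set v | P v]| = \sum_v P v.
  by rewrite -sum1_card big_mkcond; apply: eq_bigr => v _; rewrite inE; case: (P v).
rewrite cardb (eq_bigr _ (fun k _ => cardb _)) exchange_big leq_sum // => v _.
case earv: (ear v); last first.
  by rewrite big1 // => k _; rewrite covI //; apply: hcol; rewrite earv.
have [k0 hk0] := hcol' v.
rewrite (bigD1 k0) //= big1 => [|k kk]; last by rewrite covI //; apply: hk0.
by rewrite addn0; case: (cov _ _).
Qed.
Hypothesis iter_nx : forall v, iter #|G| nx v = v.

Definition skippable (v : G) : bool := (r (g v) == h v) || (r (h v) == g v).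

Lemma head_h v : head (h v) = nx v.
Proof. by rewrite -tail_flip flip_h tail_g. Qed.

Lemma adj_nx v : adj v (nx v).
Proof. by rewrite -{1}(tail_h v) -head_h adj_dart. Qed.

Lemma adj_skip v : skippable (nx v) -> adj v (nx (nx v)).
Proof.
rewrite /skippable -!flip_h => /orP[/eqP e|/eqP e].
  have := head_face2 (h v); rewrite (faceE (h v)) e tail_h.
  have := adj_dart (phi (h (nx v))).
  by rewrite tail_face head_h => ha hv; rewrite adj_sym -{2}hv.
have := head_face2 (flip G (h (nx v))); rewrite face_flip e tail_flip head_h.
have := adj_dart (phi (flip G (h v))).
by rewrite tail_face head_flip tail_h => ha <-.
Qed.

Lemma nx_inj : injective nx.
Proof.
have G0 (v : G) : 0 < #|G| by apply/card_gt0P; exists v.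
apply: (can_inj (g := iter #|G|.-1 nx)) => v.
by rewrite -iterSr (prednK (G0 v)) iter_nx.
Qed.

Lemma dominating_cover v0 (D : seq nat) :
  let f i := skippable (iter i nx v0) in
  (forall q, q < #|G| -> has (reaches f ^~ q) D) ->
  domination_number G <= size D.
Proof.
move=> f hD; have -> : size D = size [seq iter i nx v0 | i <- D] by rewrite size_map.
apply: leq_trans (card_size _).
rewrite -cardsE; apply: domination_number_le.
apply/forallP=> w; have [q /hD /hasP[c cD hc] ->] := nx_trans v0 w.
have cin : iter c nx v0 \in [set x in [seq iter i nx v0 | i <- D]].
  by rewrite in_set; apply/mapP; exists c.
have hexists : adj (iter q nx v0) (iter c nx v0) ->
    [exists w in [set x in [seq iter i nx v0 | i <- D]], adj (iter q nx v0) w].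
  by move=> ha; apply/existsP; exists (iter c nx v0); rewrite cin.
case/or4P: hc => [/eqP->|/eqP qc|/eqP qc|]; first by rewrite cin.
- by rewrite hexists ?orbT // qc adj_sym adj_nx.
- by rewrite hexists ?orbT // qc adj_nx.
case/orP=> /andP[/eqP qc hs]; rewrite hexists ?orbT // qc.
- by rewrite adj_sym; apply: adj_skip.
- exact: adj_skip.
Qed.

Lemma gaps_card v0 :
  gaps (fun i => skippable (iter i nx v0)) 0 #|G| = #|[set v | ~~ skippable v]|.
Proof.
pose s := [seq iter i nx v0 | i <- iota 0 #|G|].
have hs : perm_eq s (enum G).
  have sub : {subset enum G <= s}.
    move=> w _; have [i hi ->] := nx_trans v0 w.
    by apply/mapP; exists i; rewrite ?mem_iota.
  have sz : size s <= size (enum G) by rewrite size_map size_iota -cardE.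
  apply: uniq_perm; rewrite ?enum_uniq //.
    exact: leq_size_uniq (enum_uniq G) sub sz.
  by move=> w; have [_ ->] := uniq_min_size (enum_uniq G) sub sz.
rewrite /gaps -(count_map _ (fun v => ~~ skippable v)) -/s (seq.permP hs).
by rewrite -sum1_count big_enum_cond -sum1_card; apply: eq_bigl => v; rewrite inE.
Qed.

Lemma domination_number_skip : 0 < #|G| ->
  5 * domination_number G <= #|G| + #|[set v | ~~ skippable v]| + 4.
Proof.
move=> G0; have /card_gt0P[v0 _] := G0.
have [D [hD]] := cover_interval (fun i => skippable (iter i nx v0)) 0 G0.
rewrite gaps_card => hle.
have := @dominating_cover v0 D (fun q hq => hD q hq); lia.
Qed.

Lemma domination_number_skip_sparse : 5 < #|G| ->
  #|G| < 3 * #|[set v | ~~ skippable v]| ->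
  5 * domination_number G <= #|G| + #|[set v | ~~ skippable v]| + 2.
Proof.
move=> G5 hN; pose m v := ~~ skippable v.
have start u : m u -> m (iter #|G|.-1 nx u) \/ ~~ m (nx u) /\ m (nx (nx u)) ->
    5 * domination_number G <= #|G| + #|[set v | ~~ skippable v]| + 2.
  move=> mu hu.
  have [||D [hD]] := @cover_interval_gap_start
      (fun i => skippable (iter i nx u)) #|G| 0 G5.
  - exact: mu.
  - by case: hu => [hu|[/negPn h1 h2]]; [left|right].
  rewrite gaps_card => hle.
  have := @dominating_cover u D (fun q hq => hD q hq); lia.
have nxK u : iter #|G|.-1 nx (nx u) = u by rewrite -iterSr prednK ?iter_nx //; lia.
have cardm : #|[set v | ~~ skippable v]| = \sum_v m v.
  by rewrite -sum1_card big_mkcond; apply: eq_bigr => v _; rewrite inE /m; case: skippable.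
have [/existsP[u]|/existsPn hno] := boolP [exists u, 1 < m u + m (nx u) + m (nx (nx u))].
  have := @start u; have := @start (nx u); have := @start (nx (nx u)).
  rewrite !nxK; case: (m u); case: (m (nx u)); case: (m (nx (nx u))) => //= h1 h2 h3 _;
  first [by apply: h2 => //; left | by apply: h1 => //; left | by apply: h3 => //; right].
have : \sum_u (m u + m (nx u) + m (nx (nx u))) <= \sum_(u : G) 1.
  by apply: leq_sum => u _; rewrite leqNgt.
have -> : \sum_(u : G) 1 = #|G| by rewrite sum1_card; apply: eq_card.
rewrite !big_split /=.
rewrite -(reindex_inj nx_inj (F := fun u => m (nx u) : nat) (P := predT)).
rewrite -(reindex_inj nx_inj (F := fun u => m u : nat) (P := predT)).
rewrite -cardm => hc; move: hN.
by rewrite ltnNge !mulSn mul0n addn0 addnA hc.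
Qed.

End Hamilton.
End Triangulation.

Section HamiltonCycle.
Variables (G : sgraph) (H : seq G).
Hypothesis hH : hamilton_cycle H.

Lemma hamilton_cycle_rev : hamilton_cycle (rev H).
Proof.
case: hH => h1 h2 h3 h4; split; rewrite ?size_rev ?rev_uniq ?rev_cycle //.
  by rewrite (eq_cycle (e' := @adj G)) // => x y; apply: adj_sym.
by move=> v; rewrite mem_rev.
Qed.

Lemma card_hamilton : #|G| = size H.
Proof.
case: hH => _ h2 _ h4; rewrite -(card_uniqP h2); apply: eq_card => v.
by rewrite h4.
Qed.

Lemma next_iter v : iter #|G| (next H) v = v /\
  forall w, exists2 i, i < #|G| & w = iter i (next H) v.
Proof.
case: hH => _ h2 _ h4; have [i s rs] := rot_to (h4 v).
have sz : #|G| = (size s).+1 by rewrite card_hamilton -(size_rot i) rs.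
have hc : fcycle (next H) (v :: s) by rewrite -rs rot_cycle cycle_next.
split=> [|w].
  have := fcycle_rconsE hc; rewrite trajectSr => /rcons_inj[_ e].
  by rewrite sz iterS -e.
have : w \in v :: s by rewrite -rs mem_rot h4.
by rewrite (fcycle_consE hc) -sz => /trajectP[j jn ->]; exists j.
Qed.

Lemma adj_next v : adj v (next H v).
Proof. by case: hH => _ _ h3 h4; apply: next_cycle. Qed.

Definition next_dart v : dart G := Sub (v, next H v) (adj_next v).

Lemma next_neq_prev v : next H v != prev H v.
Proof.
case: (hH) => h1 h2 _ _; apply/eqP=> e.
have e2 : next H (next H v) = v by rewrite e next_prev.
have : #|G| <= #|[set v; next H v]|.
  apply: subset_leq_card; apply/subsetP=> w _; rewrite !inE.
  have [_ /(_ w)[i _ ->]] := next_iter v.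
  elim: i => [|i IH]; first by rewrite /= eqxx.
  by rewrite iterS; case/orP: IH => /eqP->; rewrite ?e2 eqxx ?orbT.
rewrite card_hamilton cards2; case: (_ != _); lia.
Qed.

End HamiltonCycle.

Lemma flip_next_dart (G : sgraph) (H K : seq G) (hH : hamilton_cycle H)
    (hK : hamilton_cycle K) v :
  cancel (next H) (next K) ->
  flip G (next_dart hH v) = next_dart hK (next H v).
Proof.
move=> HK; apply: dart_inj; first by rewrite tail_flip.
by rewrite head_flip /tail /Defs.head /= HK.
Qed.

Lemma min_degree_le (G : sgraph) (v : G) : min_degree G <= degree v.
Proof.
rewrite /min_degree; elim: (index_enum G) (mem_index_enum v) => // u s IH.
rewrite big_cons inE => /predU1P[<-|/IH]; first exact: geq_minl.
by apply: leq_trans; apply: geq_minr.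
Qed.

Lemma degree_two_ears (G : sgraph) (r : {perm dart G}) (x y : dart G) :
  plane_triangulation r -> tail x = tail y -> r x = y -> r y = x ->
  degree (tail x) <= 2.
Proof.
move=> [[hrot _ _] _] xy rx ry.
apply: (@leq_trans #|[set Defs.head x; Defs.head y]|); last first.
  by rewrite cards2; case: (_ != _).
apply: subset_leq_card; apply/subsetP=> w; rewrite !inE => aw.
pose z : dart G := Sub (tail x, w) aw.
have /porbitP[i zi] : z \in porbit r x by rewrite hrot.
have -> : w = Defs.head z by [].
suff : (z == x) || (z == y) by case/orP=> /eqP->; rewrite eqxx ?orbT.
rewrite zi; elim: i {zi} => [|i]; first by rewrite expg0 perm1 eqxx.
by rewrite expgSr permM => /orP[/eqP->|/eqP->]; rewrite ?rx ?ry eqxx ?orbT.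
Qed.

Theorem theorem4p2 (G : sgraph) (r : {perm dart G}) (n : nat)
    (hG : plane_triangulation r) (hn : #|G| = n) (hdeg : 4 <= min_degree G)
    (H : seq G) (hH : hamilton_cycle H) :
  domination_number G <= maxn (ceil_divn (2 * n) 7) ((5 * n) %/ 16).
Proof.
have hK := hamilton_cycle_rev hH; have [hsz uH _ _] := hH.
pose h := next_dart hH; pose g := next_dart hK.
have nextK : next (rev H) =1 prev H by apply: next_rev.
have flip_h v : flip G (h v) = g (next H v).
  by apply: flip_next_dart => u; rewrite nextK prev_next.
have flip_g v : flip G (g v) = h (next (rev H) v).
  by apply: flip_next_dart => u; rewrite nextK next_prev.
have hg v : h v != g v.
  apply/eqP=> /(congr1 (@Defs.head G)); rewrite /Defs.head /= nextK => /eqP.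
  exact/negP/next_neq_prev.
have gh v : g v != h v by rewrite eq_sym.
have tr v w := (next_iter hH v).2 w.
have tr' v w := (next_iter hK v).2 w.
have itr v := (next_iter hH v).1.
have th v : tail (h v) = v by [].
have tg v : tail (g v) = v by [].
have b1 := domination_number_side hG th tg flip_h hg tr.
have b2 := domination_number_side hG tg th flip_g gh tr'.
have G3 : 2 < #|G| by rewrite (card_hamilton hH).
have b3 := domination_number_skip hG th tg flip_h tr (ltnW (ltnW G3)).
have b4 := domination_number_skip_sparse hG th tg flip_h tr itr.
pose N := #|[set v | ~~ skippable r h g v]|.
have hN : N + (#|[set v | ear r h g v]| + #|[set v | ear r g h v]|) = #|G|.
  rewrite -(cardsC [set v | ~~ skippable r h g v]); congr addn.
  have -> : ~: [set v | ~~ skippable r h g v] =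
            [set v | ear r h g v] :|: [set v | ear r g h v].
    by apply/setP=> v; rewrite !inE negbK.
  rewrite cardsU [X in _ - X](_ : _ = 0) ?subn0 //.
  apply/eqP; rewrite cards_eq0; apply/eqP/setP=> v; rewrite !inE.
  apply/negP=> /andP[/eqP e1 /eqP e2].
  have := @degree_two_ears _ r (h v) (g v) hG erefl e2 e1.
  have := min_degree_le (tail (h v)); lia.
move: b1 b2 b3 b4 hN; rewrite -/N hn /ceil_divn; lia.
Qed.
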